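(* Let $d\in\{2,3\}$. There is a constant $C>0$, independent of $n_0$, $L$ (hence of $n_1=n_0L+1$), $\alpha$, $\lambda$ and the realization $\mathcal{K}$, such that the following holds. Let $n_0=2^{p_0}$ with $p_0\ge 2$, let $L\ge 1$ be an integer, let $\alpha$ be such that $2\alpha n_0\in\{2,4,\dots,n_0\}$, let $0<\lambda\le 1$ and $\beta=1-\lambda$, and let $\mathcal{K}\subseteq\{0,\dots,L-1\}^d$ be any set of cells (a realization of the checkerboard coefficient). Let $A=\lambda A_\Delta+\beta\widehat A_s$ be the associated stiffness matrix and let $B_\Delta=\frac{1+\lambda}{2}A_\Delta$. Then, on the subspace $\{\mathbf{u}\in\mathbb{R}^{n_1^d}:\langle \mathbf{u},\mathbf{1}\rangle=0\}$, the preconditioned matrix $B_\Delta^{+}A$ satisfies $$\mathrm{cond}\{B_\Delta^{+}A\}\le C\lambda^{-1}.$$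
   Context: Notation: $n_1=n_0L+1$; $\mathbf{1}\in\mathbb{R}^{n_1^d}$ is the all-ones vector; $\otimes$ is the Kronecker product; $B^{+}$ is the Moore–Penrose pseudo-inverse (so $B_\Delta^+B_\Delta\mathbf{u}=\mathbf{u}$ if $\langle\mathbf{u},\mathbf{1}\rangle=0$, and $B_\Delta^+\mathbf{1}=0$). The condition number of $B_\Delta^+A$ on the subspace $\langle\mathbf{u},\mathbf{1}\rangle=0$ is the ratio of the largest to the smallest eigenvalue of the restriction of $B_\Delta^+A$ to this (invariant) subspace. Periodic Laplacian: $\Delta_P\in\mathbb{R}^{n_1\times n_1}$ is the circulant matrix with first column $(2,-1,0,\dots,0,-1)^T$, and $A_\Delta=\Delta_P\otimes I+I\otimes\Delta_P$ for $d=2$, $A_\Delta=\Delta_P\otimes I\otimes I+I\otimes\Delta_P\otimes I+I\otimes I\otimes\Delta_P$ for $d=3$, with $I$ the $n_1\times n_1$ identity. Stochastic part: put $\overline n_0=2\alpha n_0+1$. Let $\widehat Q\in\mathbb{R}^{\overline n_0\times\overline n_0}$ be the 1D Neumann Laplacian, i.e. the tridiagonal matrix with off-diagonal entries $-1$ and diagonal $(1,2,\dots,2,1)$, and let $\widehat I=\mathrm{diag}\{1/2,1,\dots,1,1/2\}\in\mathbb{R}^{\overline n_0\times\overline n_0}$. For $j\in\{0,\dots,L-1\}$ let $J_j\subset\{1,\dots,n_1\}$ be the set of $\overline n_0$ consecutive indices starting at $jn_0+1+\frac{n_0}{2}-\alpha n_0$ (the sub-cell of grid width $2\alpha n_0$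 centered in the $j$-th cell of $n_0$ grid intervals). Let $\overline Q_j,\overline I_j\in\mathbb{R}^{n_1\times n_1}$ be the zero matrices with the block at $J_j\times J_j$ replaced by $\widehat Q$ and $\widehat I$, respectively. Let $P^{(1)}\in\mathbb{R}^{n_1\times n_1}$ be zero except $P^{(1)}_{1,1}=P^{(1)}_{n_1,n_1}=1$ and $P^{(1)}_{1,n_1}=P^{(1)}_{n_1,1}=-1$, and let $P^{(d)}$ be the $d$-term Kronecker sum of $P^{(1)}$ (e.g. $P^{(2)}=P^{(1)}\otimes I+I\otimes P^{(1)}$). Then for $d=2$ $$\widehat A_s=\sum_{(j_1,j_2)\in\mathcal{K}}\left(\overline Q_{j_1}\otimes\overline I_{j_2}+\overline I_{j_1}\otimes\overline Q_{j_2}\right)+P^{(2)},$$ and for $d=3$ $$\widehat A_s=\sum_{(j_1,j_2,j_3)\in\mathcal{K}}\left(\overline Q_{j_1}\otimes\overline I_{j_2}\otimes\overline I_{j_3}+\overline I_{j_1}\otimes\overline Q_{j_2}\otimes\overline I_{j_3}+\overline I_{j_1}\otimes\overline I_{j_2}\otimes\overline Q_{j_3}\right)+P^{(3)}.$$ The matrix $A=\lambda A_\Delta+\beta\widehat A_s$ is the discretization of $-\nabla\cdot(a\nabla)$ with periodic boundary conditions on $[0,1)^d$, where $a=1$ on the union of the chosen sub-cells and $a=\lambda$ elsewhere. *)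

(* Defs.v *)
From mathcomp Require Import all_boot all_order all_algebra.
From mathcomp Require Import classical_sets reals.
From mathcomp Require Export mxtens.

Set Implicit Arguments.
Unset Strict Implicit.
Unset Printing Implicit Defensive.

Import Order.TTheory GRing.Theory Num.Theory.
Local Open Scope ring_scope.

(** * Kronecker products with [d] factors *)

Section Kronecker.
Variable R : pzRingType.

(* The base case is a single factor, as in [ntensmx]: this way [n ^ d] is the
   dimension up to conversion and no cast is needed. *)
Fixpoint kron_rec n k : ('I_k.+1 -> 'M[R]_n) -> 'M[R]_(n ^ k.+1) :=
  if k is k'.+1 return ('I_k.+1 -> 'M[R]_n) -> 'M[R]_(n ^ k.+1) then
    fun M => M ord0 *t kron_rec (fun i => M (lift ord0 i))
  else fun M => M ord0.

Definition kron n d : ('I_d -> 'M[R]_n) -> 'M[R]_(n ^ d) :=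
  if d is k.+1 return ('I_d -> 'M[R]_n) -> 'M[R]_(n ^ d) then
    @kron_rec n k
  else fun=> 1%:M.

Definition kron_sum n d (X : 'M[R]_n) : 'M[R]_(n ^ d) :=
  \sum_(i < d) kron (fun k => if k == i then X else 1%:M).

Lemma kron_sum2 n (X : 'M[R]_n) :
  kron_sum 2 X = X *t 1%:M + 1%:M *t X.
Proof. by rewrite /kron_sum !big_ord_recl big_ord0 addr0. Qed.

Lemma kron_sum3 n (X : 'M[R]_n) :
  kron_sum 3 X = X *t (1%:M *t 1%:M) + 1%:M *t (X *t 1%:M)
                 + 1%:M *t (1%:M *t X).
Proof. by rewrite /kron_sum !big_ord_recl big_ord0 addr0 addrA. Qed.

End Kronecker.

(** * Moore-Penrose pseudo-inverse *)

Section PseudoInverse.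
Variable R : realType.

Definition moore_penrose m n (B : 'M[R]_(m, n)) (X : 'M[R]_(n, m)) : Prop :=
  [/\ B *m X *m B = B, X *m B *m X = X,
      (B *m X)^T = B *m X & (X *m B)^T = X *m B].

Definition mp_pinv m n (B : 'M[R]_(m, n)) : 'M[R]_(n, m) :=
  xget 0 [set X | moore_penrose B X]%classic.

Lemma gram_unitmx m n (F : 'M[R]_(m, n)) :
  row_free F -> F *m F^T \in unitmx.
Proof.
move=> Ffree; rewrite -row_free_unit -kermx_eq0; apply/eqP/row_matrixP => i.
rewrite row0; set v := row i _.
have vFF : v *m (F *m F^T) = 0 by apply/sub_kermxP; rewrite row_sub.
have vF0 : v *m F = 0.
  have : (v *m F) *m (v *m F)^T = 0.
    by rewrite trmx_mul mulmxA -(mulmxA v) vFF mul0mx.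
  move: (v *m F) => w /matrixP /(_ 0 0); rewrite !mxE => /eqP.
  rewrite psumr_eq0 => [/allP ww|k _]; last by rewrite mxE -expr2 sqr_ge0.
  apply/rowP => k; rewrite mxE.
  by have := ww k (mem_index_enum _); rewrite mxE -expr2 sqrf_eq0 => /eqP.
by apply: (row_free_inj Ffree); rewrite vF0 mul0mx.
Qed.

Lemma moore_penrose_factor m r n (C : 'M[R]_(m, r)) (F : 'M[R]_(r, n)) :
  row_full C -> row_free F -> exists X, moore_penrose (C *m F) X.
Proof.
move=> Cfull Ffree.
have FU : F *m F^T \in unitmx by exact: gram_unitmx.
have CU : C^T *m C \in unitmx.
  by have := @gram_unitmx _ _ C^T; rewrite trmxK /row_free mxrank_tr; apply.
set G := invmx (F *m F^T); set H := invmx (C^T *m C).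
have GT : G^T = G by rewrite /G trmx_inv trmx_mul trmxK.
have HT : H^T = H by rewrite /H trmx_inv trmx_mul trmxK.
exists (F^T *m G *m H *m C^T).
have BX : C *m F *m (F^T *m G *m H *m C^T) = C *m H *m C^T.
  by rewrite !mulmxA -(mulmxA C F) -(mulmxA C _ G) mulmxV // mulmx1.
have XB : F^T *m G *m H *m C^T *m (C *m F) = F^T *m G *m F.
  by rewrite !mulmxA -(mulmxA _ C^T C) -(mulmxA _ H) mulVmx // mulmx1.
split.
- by rewrite BX !mulmxA -(mulmxA _ C^T C) -(mulmxA _ H) mulVmx // mulmx1.
- rewrite XB !mulmxA -(mulmxA _ F F^T) -(mulmxA _ G (F *m _)) mulVmx //.
  by rewrite mulmx1.
- by rewrite BX !trmx_mul trmxK HT mulmxA.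
- by rewrite XB !trmx_mul trmxK GT mulmxA.
Qed.

Lemma mp_pinvP m n (B : 'M[R]_(m, n)) : moore_penrose B (mp_pinv B).
Proof.
apply: xgetPex.
have := moore_penrose_factor (col_base_full B) (row_base_free B).
by rewrite mulmx_base.
Qed.

Lemma moore_penrose_unique m n (B : 'M[R]_(m, n)) (X Y : 'M[R]_(n, m)) :
  moore_penrose B X -> moore_penrose B Y -> X = Y.
Proof.
move=> [BXB XBX BXT XBT] [BYB YBY BYT YBT].
have BXY : B *m X = B *m Y.
  by rewrite -[LHS]BXT -{1}BYB -mulmxA trmx_mul BXT BYT mulmxA BXB.
have XYB : X *m B = Y *m B.
  by rewrite -[LHS]XBT -{1}BYB -(mulmxA B) mulmxA trmx_mul XBT YBT
             -mulmxA (mulmxA B) BXB.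
by rewrite -XBX XYB -mulmxA BXY mulmxA YBY.
Qed.

End PseudoInverse.

(** * Condition number on a subspace *)

Section Condition.
Variables (R : realType) (N : nat).

Definition dotv (u v : 'cV[R]_N) : R := \sum_i u i 0 * v i 0.

Definition ones_orth : set 'cV[R]_N :=
  [set u | dotv u (const_mx 1) = 0]%classic.

(* For an [M]-invariant subspace [V], these are the eigenvalues of the
   restriction of the operator [u |-> M *m u] to [V]. *)
Definition spectrum_on (V : set 'cV[R]_N) (M : 'M[R]_N) : set R :=
  [set a | exists u, [/\ V u, u != 0 & M *m u = a *: u]]%classic.

Definition is_cond_on (V : set 'cV[R]_N) (M : 'M[R]_N) (c : R) : Prop :=
  exists lmax lmin : R,
    [/\ spectrum_on V M lmax /\ (forall a, spectrum_on V M a -> a <= lmax),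
        spectrum_on V M lmin /\ (forall a, spectrum_on V M a -> lmin <= a),
        0 < lmin
      & c = lmax / lmin].

End Condition.

(** * The matrices

   Indices are shifted to start at 0.  In all that follows [w] stands for the
   integer [2 * alpha * n0]: [w.+1] is the number of grid points of a
   sub-cell in each direction. *)

Section Matrices.
Variable R : realType.

Definition circulant n (c : 'cV[R]_n.+1) : 'M[R]_n.+1 :=
  \matrix_(i, j) c (i - j) 0. (* subtraction modulo [n.+1] in ['I_n.+1] *)

Definition lap_per n : 'M[R]_n.+1 :=
  circulant (\col_(i < n.+1)
    if i == 0%N :> nat then 2
    else if (i == 1%N :> nat) || (i == n :> nat) then -1 else 0).

Definition lap_neumann w : 'M[R]_w.+1 :=
  \matrix_(i < w.+1, j < w.+1)
    if i == j then (if (i == 0%N :> nat) || (i == w :> nat) then 1 else 2)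
    else if (i.+1 == j) || (j.+1 == i) then -1 else 0.

Definition half_id w : 'M[R]_w.+1 :=
  diag_mx (\row_(i < w.+1)
    if (i == 0%N :> nat) || (i == w :> nat) then 2^-1 else 1).

Definition embed_block n w (s : nat) (X : 'M[R]_w.+1) : 'M[R]_n :=
  \matrix_(i < n, j < n)
    if (s <= i <= s + w)%N && (s <= j <= s + w)%N
    then X (inord (i - s)) (inord (j - s)) else 0.

Definition corner n : 'M[R]_n.+1 :=
  \matrix_(i < n.+1, j < n.+1)
    if ((i == 0%N :> nat) || (i == n :> nat))
       && ((j == 0%N :> nat) || (j == n :> nat))
    then (if i == j then 1 else -1) else 0.

Section Cells.
Variables (d n0 L w : nat).

Local Notation n1 := (n0 * L).+1.

Definition cell_start (j : 'I_L) : nat := (j * n0 + n0./2 - w./2)%N.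

Definition Qbar (j : 'I_L) : 'M[R]_n1 :=
  embed_block n1 (cell_start j) (lap_neumann w).

Definition Ibar (j : 'I_L) : 'M[R]_n1 :=
  embed_block n1 (cell_start j) (half_id w).

Definition A_lap : 'M[R]_(n1 ^ d) := kron_sum d (lap_per (n0 * L)).

Definition A_stoch (K : {set d.-tuple 'I_L}) : 'M[R]_(n1 ^ d) :=
  \sum_(j in K) \sum_(i < d)
     kron (fun k => if k == i then Qbar (tnth j k) else Ibar (tnth j k))
  + kron_sum d (corner (n0 * L)).

Definition A_stiff (lambda : R) (K : {set d.-tuple 'I_L}) : 'M[R]_(n1 ^ d) :=
  lambda *: A_lap + (1 - lambda) *: A_stoch K.

Definition B_lap (lambda : R) : 'M[R]_(n1 ^ d) :=
  ((1 + lambda) / 2) *: A_lap.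

End Cells.

Lemma A_stoch2 n0 L w (K : {set 2.-tuple 'I_L}) :
  A_stoch n0 w K =
    \sum_(j in K) (Qbar n0 w (tnth j 0) *t Ibar n0 w (tnth j 1)
                   + Ibar n0 w (tnth j 0) *t Qbar n0 w (tnth j 1))
    + kron_sum 2 (corner (n0 * L)).
Proof.
congr (_ + _); apply: eq_bigr => j _.
rewrite !big_ord_recl big_ord0 addr0 /=.
by have -> : lift ord0 ord0 = 1 :> 'I_2 by exact: val_inj.
Qed.

Lemma A_stoch3 n0 L w (K : {set 3.-tuple 'I_L}) :
  let Q (j : 3.-tuple 'I_L) k := Qbar n0 w (tnth j k) in
  let I (j : 3.-tuple 'I_L) k := Ibar n0 w (tnth j k) in
  A_stoch n0 w K =
    \sum_(j in K) (Q j 0 *t (I j 1 *t I j 2%:R)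
                   + I j 0 *t (Q j 1 *t I j 2%:R)
                   + I j 0 *t (I j 1 *t Q j 2%:R))
    + kron_sum 3 (corner (n0 * L)).
Proof.
move=> Q I; congr (_ + _); apply: eq_bigr => j _.
rewrite !big_ord_recl big_ord0 addr0 addrA /=.
have -> : lift ord0 (lift ord0 ord0) = 2%:R :> 'I_3 by exact: val_inj.
by have -> : lift ord0 ord0 = 1 :> 'I_3 by exact: val_inj.
Qed.

End Matrices.

Arguments A_stiff {R d} n0 {L} w lambda K.
Arguments B_lap {R} d n0 L lambda.

(* Main.v *)
(* The bound holds with [C = 1].  In the Loewner order one has
   [0 <= A_stoch <= A_lap]: adding the missing cells to [K] only increases
   [A_stoch], the sum over all cells factorises into Kronecker products of
   [\sum_j Qbar j] and [\sum_j Ibar j], the edges of distinct sub-cells being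
   disjoint these are bounded by the Neumann Laplacian and the identity, and
   the periodic Laplacian is the Neumann one plus the corner matrix.  Hence
   [lambda A_lap <= A <= A_lap].  As [A_lap] is positive definite on the
   complement of its kernel (the constants), the eigenvalues of the
   preconditioned matrix there are those of the pencil [A u = a B u], which are
   real and lie between [lambda / t] and [1 / t] with [t = (1 + lambda) / 2]. *)
Require Import Defs.
From mathcomp Require Import all_boot all_order all_algebra.
From mathcomp Require Import classical_sets reals.
From mathcomp Require Import boolp spectral complex polyrcf ring lra zify.

Set Implicit Arguments.
Unset Strict Implicit.
Unset Printing Implicit Defensive.

Import Order.TTheory GRing.Theory Num.Theory.
Local Open Scope ring_scope.

(** * Positive semidefinite matrices and the Loewner order *)

Section PositiveSemidefinite.
Variable R : realType.

(** Encoding by a Gram factor makes symmetry automatic; sums and Kronecker products are obtained by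
    stacking or tensoring the factors. *)
Definition psd n (X : 'M[R]_n) : Prop :=
  exists m (F : 'M[R]_(m, n)), X = F^T *m F.

Definition qform n (X : 'M[R]_n) (u : 'cV[R]_n) : R := (u^T *m X *m u) 0 0.

Lemma qformD n (X Y : 'M[R]_n) u : qform (X + Y) u = qform X u + qform Y u.
Proof. by rewrite /qform mulmxDr mulmxDl mxE. Qed.

Lemma qformZ n a (X : 'M[R]_n) u : qform (a *: X) u = a * qform X u.
Proof. by rewrite /qform -scalemxAr -scalemxAl mxE. Qed.

Lemma qformB n (X Y : 'M[R]_n) u : qform (X - Y) u = qform X u - qform Y u.
Proof. by rewrite -scaleN1r qformD qformZ mulN1r. Qed.

Lemma qform_gram m n (F : 'M[R]_(m, n)) u :
  qform (F^T *m F) u = \sum_i (F *m u) i 0 ^+ 2.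
Proof.
rewrite /qform mulmxA -trmx_mul -mulmxA mxE.
by apply: eq_bigr => i _; rewrite [_^T _ _]mxE expr2.
Qed.

Lemma psd_qform_ge0 n (X : 'M[R]_n) u : psd X -> 0 <= qform X u.
Proof.
by case=> m [F ->]; rewrite qform_gram; apply: sumr_ge0 => i _; exact: sqr_ge0.
Qed.

(** The form is the squared norm of [F *m u], so its vanishing kills [F *m u] itself. *)
Lemma psd_qform_eq0 n (X : 'M[R]_n) u : psd X -> qform X u = 0 -> X *m u = 0.
Proof.
case=> m [F ->] /eqP; rewrite qform_gram psumr_eq0 => [/allP F0|i _]; last first.
  exact: sqr_ge0.
suff -> : F^T *m F *m u = F^T *m (F *m u).
  suff -> : F *m u = 0 by rewrite mulmx0.
  apply/colP => i; rewrite [RHS]mxE.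
  by have := F0 i (mem_index_enum _); rewrite /= sqrf_eq0 => /eqP.
by rewrite mulmxA.
Qed.

Lemma psd_sym n (X : 'M[R]_n) : psd X -> X^T = X.
Proof. by case=> m [F ->]; rewrite trmx_mul trmxK. Qed.

Lemma psd_gram m n (F : 'M[R]_(m, n)) : psd (F^T *m F).
Proof. by exists m, F. Qed.

Lemma psd0 n : psd (0 : 'M[R]_n).
Proof. by exists n, 0; rewrite mulmx0. Qed.

Lemma psd1 n : psd (1%:M : 'M[R]_n).
Proof. by exists n, 1%:M; rewrite trmx1 mulmx1. Qed.

Lemma psdD n (X Y : 'M[R]_n) : psd X -> psd Y -> psd (X + Y).
Proof.
case=> m [F ->] [p [G ->]]; exists (m + p)%N, (col_mx F G).
by rewrite tr_col_mx mul_row_col.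
Qed.

Lemma psd_sum n (I : Type) (r : seq I) (P : pred I) (X : I -> 'M[R]_n) :
  (forall i, P i -> psd (X i)) -> psd (\sum_(i <- r | P i) X i).
Proof.
by move=> psdX; elim/big_ind: _ => //; [exact: psd0 | exact: psdD].
Qed.

Lemma psdZ n a (X : 'M[R]_n) : 0 <= a -> psd X -> psd (a *: X).
Proof.
move=> a0 [m [F ->]]; exists m, (Num.sqrt a *: F).
have -> : (Num.sqrt a *: F)^T = Num.sqrt a *: F^T by rewrite linearZ.
by rewrite -scalemxAl -scalemxAr scalerA -expr2 sqr_sqrtr.
Qed.

Lemma psd_diag n (v : 'rV[R]_n) : (forall i, 0 <= v 0 i) -> psd (diag_mx v).
Proof.
move=> v0; exists n, (diag_mx (\row_i Num.sqrt (v 0 i))).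
rewrite tr_diag_mx mulmx_diag; congr diag_mx; apply/rowP => i.
by rewrite !mxE -expr2 sqr_sqrtr.
Qed.

Lemma psd_tens m n (X : 'M[R]_m) (Y : 'M[R]_n) :
  psd X -> psd Y -> psd (X *t Y).
Proof.
case=> p [F ->] [q [G ->]]; exists (p * q)%N, (F *t G).
by rewrite trmx_tens tensmx_mul.
Qed.

Lemma psd_le_trans n (X Y Z : 'M[R]_n) :
  psd (Y - X) -> psd (Z - Y) -> psd (Z - X).
Proof. by move=> XY YZ; rewrite -(subrK Y Z) -addrA; apply: psdD. Qed.

Lemma tensmxDr m n p q (X : 'M[R]_(m, n)) (Y Y' : 'M[R]_(p, q)) :
  X *t (Y + Y') = X *t Y + X *t Y'.
Proof. by apply/matrixP => i j; rewrite !mxE mulrDr. Qed.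

(** Telescoping: one factor changes at a time, which is why positivity is asked of the old first
    factor [X] and of the new second factor [Y']. *)
Lemma psd_tens_le m n (X X' : 'M[R]_m) (Y Y' : 'M[R]_n) :
  psd X -> psd (X' - X) -> psd Y' -> psd (Y' - Y) ->
  psd (X' *t Y' - X *t Y).
Proof.
move=> pX leX pY' leY.
have -> : X' *t Y' - X *t Y = (X' - X) *t Y' + X *t (Y' - Y).
  by apply/matrixP => i j; rewrite !mxE mulrBl mulrBr addrA subrK.
by apply: psdD; apply: psd_tens.
Qed.

Lemma psd_kron n d (M : 'I_d -> 'M[R]_n) :
  (forall k, psd (M k)) -> psd (kron M).
Proof.
case: d M => [|d] M pM; first exact: psd1.
rewrite /kron; elim: d M pM => [|d IH] M pM; first exact: pM.
by apply: psd_tens; [exact: pM | apply: IH => k; exact: pM].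
Qed.

Lemma psd_kron_le n d (M M' : 'I_d -> 'M[R]_n) :
  (forall k, psd (M k)) -> (forall k, psd (M' k - M k)) ->
  psd (kron M' - kron M).
Proof.
case: d M M' => [|d] M M' pM leM; first by rewrite subrr; exact: psd0.
rewrite /kron; elim: d M M' pM leM => [|d IH] M M' pM leM; first exact: leM.
apply: psd_tens_le; [exact: pM | exact: leM | | exact: IH].
(* Each larger factor is semidefinite, being the smaller one plus a semidefinite gap. *)
apply: (@psd_kron _ d.+1) => k.
by rewrite -[M' _](subrK (M (lift ord0 k))); apply: psdD.
Qed.

End PositiveSemidefinite.

(** * Kronecker products entrywise, and kernels of Kronecker sums *)

Section Tensor.
Variable R : realType.

(** [dig i] lists the coordinates of the multi-index flattened to [i]. It does not depend on [M], so
    identities between Kronecker products reduce to identities between products of scalars. *)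
Lemma kron_coef n d : exists dig : 'I_(n ^ d) -> 'I_d -> 'I_n,
  forall (M : 'I_d -> 'M[R]_n) i j,
    kron M i j = \prod_k M k (dig i k) (dig j k).
Proof.
case: d => [|d].
  exists (fun _ (k : 'I_0) => False_rect _ (notF (ltn_ord k))) => M i j.
  by rewrite big_ord0 /kron mxE (ord1 i) (ord1 j) eqxx.
rewrite /kron; elim: d => [|d [dig digP]].
  by exists (fun i _ => i) => M i j; rewrite big_ord1.
exists (fun i k => if unlift ord0 k is Some k'
                   then dig (@mxtens_unindex n (n ^ d.+1) i).2 k'
                   else (@mxtens_unindex n (n ^ d.+1) i).1) => M i j.
rewrite big_ord_recl unlift_none [LHS]mxE digP; congr (_ * _).
by apply: eq_bigr => k _; rewrite liftK.
Qed.

(** Entrywise this is distributivity of a product over sums; the choice functions are recoded as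
    tuples to match the cells. *)
Lemma kron_distr n d L (M : 'I_d -> 'I_L -> 'M[R]_n) :
  kron (fun k => \sum_l M k l)
  = \sum_(j : d.-tuple 'I_L) kron (fun k => M k (tnth j k)).
Proof.
have [dig digP] := kron_coef n d.
apply/matrixP => a b; rewrite digP summxE.
under eq_bigr do rewrite summxE.
rewrite bigA_distr_bigA.
rewrite (reindex (fun j : d.-tuple 'I_L => [ffun k => tnth j k])) /=; last first.
  exists (fun f : {ffun 'I_d -> 'I_L} => [tuple f k | k < d]) => f _.
    by apply: eq_from_tnth => k; rewrite tnth_mktuple ffunE.
  by apply/ffunP => k; rewrite ffunE tnth_mktuple.
apply: eq_bigr => j _; rewrite digP; apply: eq_bigr => k _.
by rewrite ffunE.
Qed.

(** Each summand contains the argument in exactly one factor, hence is additive in it. *)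
Lemma kron_sumD m d (X Y : 'M[R]_m) :
  kron_sum d (X + Y) = kron_sum d X + kron_sum d Y.
Proof.
have [dig digP] := kron_coef m d.
rewrite /kron_sum -big_split; apply: eq_bigr => i _ /=.
apply/matrixP => a b; rewrite mxE !digP.
rewrite !(bigD1 (P := xpredT) i) //= !eqxx mxE mulrDl; congr (_ * _ + _ * _);
  by apply: eq_bigr => k /negPf ->.
Qed.

Lemma kron1 n d : kron (fun _ : 'I_d => 1%:M) = 1%:M :> 'M[R]_(n ^ d).
Proof.
case: d => [//|d]; rewrite /kron; elim: d => [//|d /= ->].
apply/matrixP => i j.
case: (mxtens_indexP i) => a b; case: (mxtens_indexP j) => a' b'.
rewrite tensmxE !mxE -natrM mulnb -xpair_eqE.
by rewrite (inj_eq (can_inj (@mxtens_indexK _ _))).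
Qed.

(** Splits off the first coordinate, for induction on the dimension. *)
Lemma kron_sumS n d (X : 'M[R]_n) :
  kron_sum d.+2 X = X *t 1%:M + 1%:M *t kron_sum d.+1 X.
Proof.
rewrite /kron_sum big_ord_recl; congr (_ + _).
  by rewrite -(kron1 n d.+1).
have -> : 1%:M *t (\sum_(i < d.+1) kron (fun k => if k == i then X else 1%:M))
  = \sum_(i < d.+1) 1%:M *t kron (fun k => if k == i then X else 1%:M)
  :> 'M_(n * n ^ d.+1).
  elim/big_rec2: _ => [|i Y Y' _ <-]; first by rewrite tensmx0.
  by rewrite tensmxDr.
by apply: eq_bigr => i _.
Qed.

(* The columns and rows of [u], viewed as an [m] by [n] array. *)
Definition slicel m n (u : 'cV[R]_(m * n)) (b : 'I_n) : 'cV[R]_m :=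
  \col_a u (mxtens_index (a, b)) 0.
Definition slicer m n (u : 'cV[R]_(m * n)) (a : 'I_m) : 'cV[R]_n :=
  \col_b u (mxtens_index (a, b)) 0.

Lemma tensmx_cV m n (X : 'M[R]_m) (Y : 'M[R]_n) (u : 'cV[R]_(m * n)) a b :
  (X *t Y *m u) (mxtens_index (a, b)) 0
  = \sum_a' \sum_b' X a a' * Y b b' * u (mxtens_index (a', b')) 0.
Proof.
rewrite mxE pair_big /=.
rewrite (reindex (@mxtens_index m n)) /=; last first.
  by exists (@mxtens_unindex m n) => k _; rewrite (mxtens_indexK, mxtens_unindexK).
by apply: eq_bigr => -[a' b'] _; rewrite tensmxE.
Qed.

Lemma tensmx1_cV m n (X : 'M[R]_m) (u : 'cV[R]_(m * n)) a b :
  (X *t 1%:M *m u) (mxtens_index (a, b)) 0 = (X *m slicel u b) a 0.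
Proof.
rewrite tensmx_cV [RHS]mxE; apply: eq_bigr => a' _.
rewrite (bigD1 b) //= big1 => [|b' /negPf bb'].
  by rewrite addr0 !mxE eqxx mulr1.
by rewrite mxE eq_sym bb' mulr0 mul0r.
Qed.

Lemma tens1mx_cV m n (Y : 'M[R]_n) (u : 'cV[R]_(m * n)) a b :
  (1%:M *t Y *m u) (mxtens_index (a, b)) 0 = (Y *m slicer u a) b 0.
Proof.
rewrite tensmx_cV [RHS]mxE (bigD1 a) //= [X in _ + X]big1 => [|a' /negPf aa'].
  by rewrite addr0; apply: eq_bigr => b' _; rewrite !mxE eqxx mul1r.
by rewrite big1 // => b' _; rewrite mxE eq_sym aa' !mul0r.
Qed.

Definition kernel_constant n (X : 'M[R]_n) : Prop :=
  X *m const_mx 1 = 0 :> 'cV_n /\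
  forall u : 'cV[R]_n, X *m u = 0 -> forall i j, u i 0 = u j 0.

(** Both summands are semidefinite, so a null vector of the sum is null for each. Then [X] makes [u]
    constant in the first index and [Y] in the second. *)
Lemma kernel_constant_tensD m n (X : 'M[R]_m) (Y : 'M[R]_n) :
  psd X -> psd Y -> kernel_constant X -> kernel_constant Y ->
  kernel_constant (X *t 1%:M + 1%:M *t Y).
Proof.
move=> pX pY [X1 kX] [Y1 kY]; split=> [|u].
  apply/colP => i; case: (mxtens_indexP i) => a b {i}.
  rewrite mulmxDl mxE tensmx1_cV tens1mx_cV.
  have -> : slicel (const_mx 1 : 'cV_(m * n)) b = const_mx 1.
    by apply/colP => i; rewrite !mxE.
  have -> : slicer (const_mx 1 : 'cV_(m * n)) a = const_mx 1.
    by apply/colP => i; rewrite !mxE.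
  by rewrite X1 Y1 !mxE addr0.
move=> /(congr1 (fun v => (u^T *m v) 0 0)).
rewrite mulmxA -/(qform _ u) qformD mulmx0 mxE => /eqP.
have pXI : psd (X *t (1%:M : 'M[R]_n)) by apply: psd_tens => //; exact: psd1.
have pIY : psd ((1%:M : 'M[R]_m) *t Y) by apply: psd_tens => //; exact: psd1.
rewrite paddr_eq0 ?psd_qform_ge0 // => /andP[/eqP XI0 /eqP IY0].
have XIu := psd_qform_eq0 pXI XI0; have IYu := psd_qform_eq0 pIY IY0.
have row_const b a a' :
    u (mxtens_index (a, b)) 0 = u (mxtens_index (a', b)) 0.
  have := kX (slicel u b) _ a a'; rewrite !mxE; apply.
  by apply/colP => c; rewrite -tensmx1_cV XIu !mxE.
have col_const a b b' :
    u (mxtens_index (a, b)) 0 = u (mxtens_index (a, b')) 0.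
  have := kY (slicer u a) _ b b'; rewrite !mxE; apply.
  by apply/colP => c; rewrite -tens1mx_cV IYu !mxE.
move=> i j; case: (mxtens_indexP i) => a b; case: (mxtens_indexP j) => a' b'.
by rewrite (row_const b a a') (col_const a' b b').
Qed.

Lemma psd_kron_sum n d (X : 'M[R]_n) : psd X -> psd (kron_sum d X).
Proof.
move=> pX; apply: psd_sum => i _; apply: psd_kron => k.
by case: ifP => _ //; exact: psd1.
Qed.

Lemma kernel_constant_kron_sum n d (X : 'M[R]_n) :
  psd X -> kernel_constant X -> kernel_constant (kron_sum d.+1 X).
Proof.
move=> pX kX; elim: d => [|d IH]; first by rewrite /kron_sum big_ord1.
rewrite kron_sumS.
exact: (kernel_constant_tensD pX (psd_kron_sum d.+1 pX) kX IH).
Qed.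

End Tensor.

(** * Extremal eigenvalues, and complex eigenvectors in real terms *)

Section Spectrum.
Variable R : realType.

(** Induction on the list: [y] is removed from both the list and the set, and the maximum of the
    rest is compared with [y]. *)
Lemma seq_bounded_max (S : set R) (s : seq R) :
  (exists x, S x) -> (forall x, S x -> x \in s) ->
  exists m, S m /\ forall x, S x -> x <= m.
Proof.
elim: s S => [|y s IH] S [x Sx] Ss; first by have := Ss _ Sx.
have [[z [Sz zy]]|noz] := pselect (exists z, S z /\ z != y); last first.
  have Sy z : S z -> z = y.
    by move=> Sz; apply/eqP/negPn/negP => zy; apply: noz; exists z.
  by exists x; split=> // z /Sy ->; rewrite (Sy x).
have [||m [[Sm my] mP]] := IH [set t | S t /\ t != y]%classic.
- by exists z.
- by move=> t [St /negPf ty]; have := Ss t St; rewrite inE ty.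
have [Sy|nSy] := pselect (S y); last first.
  exists m; split=> // t St; apply: mP; split=> //.
  by apply/eqP => ty; apply: nSy; rewrite -ty.
have [ym|my'] := leP y m.
  exists m; split=> // t St; have [->//|ty] := eqVneq t y.
  by apply: mP.
exists y; split=> // t St; have [->//|ty] := eqVneq t y.
by apply: le_trans (ltW my'); apply: mP.
Qed.

Lemma seq_bounded_min (S : set R) (s : seq R) :
  (exists x, S x) -> (forall x, S x -> x \in s) ->
  exists m, S m /\ forall x, S x -> m <= x.
Proof.
move=> [x Sx] Ss.
have [||m [Sm mP]] := @seq_bounded_max [set t | S (- t)]%classic (map -%R s).
- by exists (- x); rewrite /= opprK.
- by move=> t /Ss ts; rewrite -[t]opprK map_f.
exists (- m); split=> // t St; rewrite lerNl; apply: mP.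
by rewrite /= opprK.
Qed.

(** Provides a finite list containing the spectrum. The transpose appears because [eigenvalue]
    refers to row vectors. *)
Lemma spectrum_on_roots N (V : set 'cV[R]_N) (M : 'M[R]_N) a :
  spectrum_on V M a -> a \in rootsR (char_poly M^T).
Proof.
case=> u [_ u0 Mu].
have p0 : char_poly M^T != 0 by exact/monic_neq0/char_poly_monic.
rewrite -(roots_on_rootsR p0) /=.
rewrite -eigenvalue_root_char; apply/eigenvalueP; exists u^T.
  by rewrite -trmx_mul Mu linearZ.
by rewrite trmx_eq0.
Qed.

(** [x] and [y] are the real and imaginary parts of an eigenvector over the algebraically closed
    field [R[i]], with eigenvalue [a + ib]. *)
Lemma complex_eigenpair n (M : 'M[R]_n) : (0 < n)%N ->
  exists a b (x y : 'rV[R]_n),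
    [/\ (x != 0) || (y != 0), x *m M = a *: x - b *: y
      & y *m M = b *: x + a *: y].
Proof.
move=> n0.
have [mu] := eigenvalue_closed (map_mx (real_complex R) M) n0.
case/eigenvalueP => z zM z0.
exists (complex.Re mu), (complex.Im mu).
exists (map_mx (@complex.Re R) z), (map_mx (@complex.Im R) z).
have zMi i : \sum_j z 0 j * (M j i)%:C%C = mu * z 0 i.
  move/rowP/(_ i): zM; rewrite !mxE => <-.
  by apply: eq_bigr => j _; rewrite mxE.
split.
- apply: contra_neqT z0; rewrite negb_or !negbK => /andP[/eqP/rowP x0 /eqP/rowP y0].
  apply/rowP => i; have := x0 i; have := y0 i; rewrite !mxE.
  by case: (z 0 i) => p q /= -> ->.
- apply/rowP => i; have /(congr1 (@complex.Re R)) := zMi i.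
  rewrite raddf_sum /= !mxE => H.
  transitivity (complex.Re (mu * z 0 i)); last by case: (z 0 i) => p q; case: (mu).
  rewrite -H; apply: eq_bigr => j _; rewrite mxE.
  by case: (z 0 j) => p q /=; ring.
- apply/rowP => i; have /(congr1 (@complex.Im R)) := zMi i.
  rewrite raddf_sum /= !mxE => H.
  transitivity (complex.Im (mu * z 0 i)); last first.
    by case: (z 0 i) => p q; case: (mu) => s t /=; ring.
  rewrite -H; apply: eq_bigr => j _; rewrite mxE.
  by case: (z 0 j) => p q /=; ring.
Qed.

Lemma ones_orthE N (u : 'cV[R]_N) :
  ones_orth u <-> u^T *m (const_mx 1 : 'cV_N) = 0.
Proof.
rewrite /ones_orth /= /dotv; split=> [u1|/matrixP/(_ 0 0)].
  apply/matrixP => i j; rewrite !ord1 !mxE -[RHS]u1.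
  by apply: eq_bigr => k _; rewrite !mxE.
by rewrite !mxE => u1; rewrite -[RHS]u1; apply: eq_bigr => k _; rewrite !mxE.
Qed.

(** The rows of [W] form a basis of the complement of the constants, and [M'] represents the
    restriction of [M] in that basis. The condition [1 < N] makes this subspace nonzero. *)
Lemma complex_eigenpair_on_ones_orth N (M : 'M[R]_N) : (1 < N)%N ->
  (forall u, ones_orth u -> ones_orth (M *m u)) ->
  exists a b (x y : 'cV[R]_N),
    [/\ ones_orth x /\ ones_orth y, (x != 0) || (y != 0),
        M *m x = a *: x - b *: y & M *m y = b *: x + a *: y].
Proof.
move=> N1 MV; pose o := const_mx 1 : 'cV[R]_N.
set W := row_base (kermx o).
have Wo : W *m o = 0 by apply/sub_kermxP; rewrite eq_row_base.
have WV (x : 'rV_(\rank (kermx o))) : ones_orth (x *m W)^T.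
  by apply/ones_orthE; rewrite trmxK -mulmxA Wo mulmx0.
have /submxP[M' WM] : (W *m M^T <= W)%MS.
  rewrite eq_row_base; apply/sub_kermxP/row_matrixP => i.
  rewrite row0 2!row_mul rowE.
  rewrite -[_ *m M^T]trmxK trmx_mul trmxK.
  by apply/ones_orthE/MV/WV.
have r0 : (0 < \rank (kermx o))%N.
  by rewrite mxrank_ker subn_gt0 (leq_ltn_trans (rank_leq_col _) N1).
have [a [b [x [y [xy0 xM yM]]]]] := complex_eigenpair M' r0.
have MW (z : 'rV_(\rank (kermx o))) : M *m (z *m W)^T = (z *m M' *m W)^T.
  by rewrite -mulmxA -WM !trmx_mul trmxK !mulmxA.
have inj (z : 'rV_(\rank (kermx o))) : ((z *m W)^T != 0) = (z != 0).
  by rewrite trmx_eq0 mulmx_free_eq0 // row_base_free.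
exists a, b, (x *m W)^T, (y *m W)^T; rewrite !inj !MW xM yM; split=> //.
  by rewrite mulmxBl -!scalemxAl linearB !linearZ.
by rewrite mulmxDl -!scalemxAl linearD !linearZ.
Qed.

End Spectrum.

(** * Eigenvalues of the preconditioned matrix when [l B <= A <= m B] *)

Section Preconditioner.
Variables (R : realType) (N : nat) (A B : 'M[R]_N) (l m : R).
Hypotheses (psdB : psd B) (kerB : kernel_constant B).
Hypotheses (l_gt0 : 0 < l) (A_ge : psd (A - l *: B)) (A_le : psd (m *: B - A)).

Let P := mp_pinv B.

Lemma pencil_psd : psd A.
Proof. by rewrite -(subrK (l *: B) A); apply/psdD/psdZ => //; exact: ltW. Qed.

(** A null vector of the form is constant, and a constant vector orthogonal to the ones has [N]
    times its value equal to zero. *)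
Lemma pencil_pos (u : 'cV[R]_N) : ones_orth u -> u != 0 -> 0 < qform B u.
Proof.
move=> u1 u0; rewrite lt_def psd_qform_ge0 // andbT.
apply: contraNneq u0 => /(psd_qform_eq0 psdB) /(proj2 kerB) uc.
apply/eqP/colP => i; rewrite [RHS]mxE; move: u1; rewrite /ones_orth /= /dotv.
under eq_bigr => j _ do rewrite (uc j i) mxE mulr1.
rewrite sumr_const card_ord => /eqP; rewrite mulrn_eq0 => /orP[/eqP N0|/eqP //].
by have := leq_trans (ltn_ord i) (eq_leq N0).
Qed.

(** [B *m P] is the orthogonal projector onto the range of [B]. Since [0 <= A <= m B], [A] vanishes
    on the kernel of [B], so by symmetry its range lies in that of [B]. *)
Lemma pencil_range (u : 'cV[R]_N) : B *m P *m A *m u = A *m u.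
Proof.
have [BPB _ BPT _] := mp_pinvP B.
pose E := 1%:M - B *m P.
have ET : E^T = E by rewrite /E linearB /= trmx1 BPT.
(* Transpose of [E *m B = 0]: the columns of [E] lie in the kernel of [B]. *)
have BE : B *m E = 0.
  rewrite -[B]trmxK -[E in _ *m E]ET -trmx_mul psd_sym //.
  by rewrite mulmxBl mul1mx BPB subrr trmx0.
(* The form of [A] at [E *m v] is squeezed between 0 and [m] times the form of [B], which is 0
   there. *)
have AEv (v : 'cV[R]_N) : A *m (E *m v) = 0.
  apply: psd_qform_eq0; first exact: pencil_psd.
  have qB : qform B (E *m v) = 0 
    by rewrite /qform -mulmxA (mulmxA B) BE mul0mx mulmx0 mxE.
  have := psd_qform_ge0 (E *m v) A_le.
  have := psd_qform_ge0 (E *m v) pencil_psd.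
  rewrite qformB qformZ qB mulr0 sub0r oppr_ge0 => ge0 le0.
  by apply/eqP; rewrite eq_le ge0 le0.
have AE : A *m E = 0.
  apply/matrixP => i j; have /colP/(_ i) := AEv (delta_mx j 0).
  by rewrite mulmxA -colE !mxE.
have : E *m A = 0.
  by rewrite -(psd_sym pencil_psd) -ET -trmx_mul AE trmx0.
rewrite mulmxBl mul1mx => /eqP; rewrite subr_eq0 => /eqP EA.
by rewrite -EA.
Qed.

(** By symmetry of [P *m B] and [B], [P = P B P = B P^T P], and [B] annihilates the constants. *)
Lemma pencil_stable (u : 'cV[R]_N) : ones_orth (P *m A *m u).
Proof.
have [_ PBP _ PBT] := mp_pinvP B; rewrite -/P in PBP PBT.
apply/ones_orthE; rewrite -[LHS]trmxK -[RHS]trmx0; congr _^T.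
rewrite trmx_mul trmxK -PBP -PBT trmx_mul (psd_sym psdB) !mulmxA.
have -> : (const_mx 1 : 'cV[R]_N)^T *m B = 0.
  by rewrite -[LHS]trmxK trmx_mul trmxK psd_sym // (proj1 kerB) trmx0.
by rewrite !mul0mx.
Qed.

(** Multiplying by [B] trades the nonsymmetric product for a pencil of symmetric matrices. *)
Lemma pencil_eigen (a : R) (u : 'cV[R]_N) :
  P *m A *m u = a *: u -> A *m u = a *: (B *m u).
Proof.
by move=> Mu; rewrite -pencil_range -!mulmxA !(mulmxA P) Mu -scalemxAr.
Qed.

(** [a] is the Rayleigh quotient of [A] by [B] at its eigenvector. *)
Lemma pencil_spectrum_bounds a :
  spectrum_on (@ones_orth R N) (P *m A) a -> l <= a <= m.
Proof.
case=> u [u1 u0 /pencil_eigen Au].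
have q0 := pencil_pos u1 u0.
have qA : qform A u = a * qform B u.
  by rewrite /qform -!mulmxA Au -scalemxAr mxE.
have := psd_qform_ge0 u A_le; have := psd_qform_ge0 u A_ge.
rewrite !qformB !qformZ qA -!mulrBl !pmulr_lge0 // !subr_ge0.
by move=> -> ->.
Qed.

(* Eigenvalues of the pencil are real because [A] and [B] are symmetric and
   [B] is positive definite on the complement of the constants. *)
Lemma pencil_spectrum_nonempty : (1 < N)%N ->
  exists a, spectrum_on (@ones_orth R N) (P *m A) a.
Proof.
move=> N1.
have [u _|a [b [x [y [[x1 y1] xy0 Mx My]]]]] :=
  complex_eigenpair_on_ones_orth (M := P *m A) N1.
  exact: pencil_stable.
pose g (X : 'M[R]_N) (u v : 'cV[R]_N) : R := (u^T *m X *m v) 0 0.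
have gC X u v : psd X -> g X u v = g X v u.
  move=> pX; rewrite /g.
  have -> : u^T *m X *m v = (v^T *m X *m u)^T; last by rewrite mxE.
  by rewrite !trmx_mul trmxK psd_sym // mulmxA.
have Ax : A *m x = a *: (B *m x) - b *: (B *m y).
  by rewrite -pencil_range -!mulmxA (mulmxA P) Mx mulmxBr !scalemxAr.
have Ay : A *m y = b *: (B *m x) + a *: (B *m y).
  by rewrite -pencil_range -!mulmxA (mulmxA P) My mulmxDr !scalemxAr.
(* Equating [g A y x] and [g A x y] cancels the terms in [a] and leaves [b] times the sum of the
   [B]-energies of [x] and [y], which is positive. *)
have b0 : b = 0.
  have gyx : g A y x = a * g B y x - b * g B y y.
    by rewrite /g -!mulmxA Ax mulmxBr -!scalemxAr !mxE.
  have gxy : g A x y = b * g B x x + a * g B x y.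
    by rewrite /g -!mulmxA Ay mulmxDr -!scalemxAr !mxE.
  have /eqP : b * (g B x x + g B y y) = 0.
    have := gC _ x y pencil_psd; rewrite gyx gxy (gC _ x y psdB); lra.
  rewrite mulf_eq0 => /orP[/eqP//|].
  rewrite paddr_eq0 ?psd_qform_ge0 // => /andP[/eqP qx /eqP qy].
  case/orP: xy0 => [x0|y0].
    by have := pencil_pos x1 x0; rewrite /qform -/(g B x x) qx ltxx.
  by have := pencil_pos y1 y0; rewrite /qform -/(g B y y) qy ltxx.
exists a; case/orP: xy0 => [x0|y0]; [exists x | exists y]; split=> //.
  by rewrite Mx b0 scale0r subr0.
by rewrite My b0 scale0r add0r.
Qed.

Lemma pencil_cond : (1 < N)%N ->
  exists2 c, is_cond_on (@ones_orth R N) (P *m A) c & c <= m / l.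
Proof.
move=> N1; have ne := pencil_spectrum_nonempty N1.
have sub a := @spectrum_on_roots R N (@ones_orth R N) (P *m A) a.
have [lmax [Smax maxP]] := seq_bounded_max ne sub.
have [lmin [Smin minP]] := seq_bounded_min ne sub.
have /andP[lle _] := pencil_spectrum_bounds Smin.
have /andP[llmax lem] := pencil_spectrum_bounds Smax.
have lmin0 : 0 < lmin by apply: lt_le_trans lle.
exists (lmax / lmin); first by exists lmax, lmin.
apply: ler_pM => //; [exact/ltW/(lt_le_trans l_gt0)|by rewrite invr_ge0 ltW|].
by rewrite lef_pV2.
Qed.

End Preconditioner.

(** * One-dimensional stencils as weighted path Laplacians *)

Section PathLaplacian.
Variable R : realType.

(** A row of the incidence matrix; endpoints given as naturals cover both the path edges and the
    closing edge between [0] and [n]. *)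
Definition diff_row n (a b : nat) : 'rV[R]_n.+1 :=
  \row_(i < n.+1) ((i == a :> nat)%:R - (i == b :> nat)%:R).

(* The Laplacian of the path [0 - 1 - ... - n] with conductance [c e] on the
   edge from [e] to [e.+1]. *)
Definition path_lap n (c : nat -> R) : 'M[R]_n.+1 :=
  \sum_(e < n) c e *: ((diff_row n e e.+1)^T *m diff_row n e e.+1).

Lemma psd_path_lap n c : (forall e, 0 <= c e) -> psd (path_lap n c).
Proof. by move=> c0; apply: psd_sum => e _; apply/psdZ/psd_gram. Qed.

Lemma path_lapB n c c' :
  path_lap n (fun e => c e - c' e) = path_lap n c - path_lap n c'.
Proof. by rewrite -sumrB; apply: eq_bigr => e _; rewrite scalerBl. Qed.

Lemma path_lap_sum n (I : Type) (r : seq I) (c : I -> nat -> R) :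
  path_lap n (fun e => \sum_(j <- r) c j e) = \sum_(j <- r) path_lap n (c j).
Proof.
by rewrite exchange_big; apply: eq_bigr => e _; rewrite scaler_suml.
Qed.

Lemma sum_delta n (f : nat -> R) (i : nat) :
  \sum_(e < n) (i == e)%:R * f e = (i < n)%:R * f i.
Proof.
have [lt_in|le_ni] := ltnP i n.
  rewrite (bigD1 (Ordinal lt_in)) //= eqxx big1 ?addr0 // => e.
  by rewrite -val_eqE /= eq_sym => /negPf ->; rewrite mul0r.
rewrite mul0r big1 // => e _.
by rewrite gtn_eqF ?mul0r // (leq_trans (ltn_ord e)).
Qed.

Lemma sum_deltaS n (f : nat -> R) (i : nat) : (i <= n)%N ->
  \sum_(e < n) (i == e.+1)%:R * f e = (0 < i)%:R * f i.-1.
Proof.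
case: i => [|i] lt_in; first by rewrite mul0r big1 // => e _; rewrite mul0r.
by under eq_bigr => e _ do rewrite eqSS; rewrite sum_delta lt_in.
Qed.

(** Node [i] meets the edges [i] and [i.-1]. The indicators drop the missing edge at either end,
    notably the spurious [i.-1 = 0] at [i = 0]. *)
Lemma path_lapE n c (i k : 'I_n.+1) :
  path_lap n c i k
  = (i < n)%:R * (c i * ((k == i :> nat)%:R - (k == i.+1 :> nat)%:R))
    - (0 < i)%:R *
      (c i.-1 * ((k == i.-1 :> nat)%:R - (k == i.-1.+1 :> nat)%:R)).
Proof.
rewrite summxE.
pose f e := c e * ((k == e :> nat)%:R - (k == e.+1 :> nat)%:R).
rewrite -/(f i) -/(f i.-1) -sum_delta -(sum_deltaS f (leq_ord i)).
rewrite -sumrB; apply: eq_bigr => e _.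
by rewrite !mxE big_ord1 !mxE /f; ring.
Qed.

(* Decides a 0/1 identity by exhausting the comparisons of indices. *)
Ltac index_cases :=
  repeat (first [case: eqP => ? | case: leqP => ? ]; try (exfalso; lia)) => //=;
  first [ring | field].

Lemma lap_neumann_path n : (0 < n)%N -> lap_neumann R n = path_lap n (fun=> 1).
Proof.
move=> n0; apply/matrixP => i k; rewrite path_lapE mxE -val_eqE /=.
have := leq_ord i; have := leq_ord k; move: (i : nat) (k : nat) => a b bn an.
by index_cases.
Qed.

(** The [w.+1] nodes of the block span [w] edges, hence the half-open range. *)
Lemma embed_neumann_path n w s : (0 < w)%N -> (s + w <= n)%N ->
  embed_block n.+1 s (lap_neumann R w)
  = path_lap n (fun e => (s <= e < s + w)%:R).
Proof.
move=> w0 swn; apply/matrixP => i k; rewrite path_lapE mxE.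
have := leq_ord i; have := leq_ord k; case: ifPn => [/andP[si sk]|].
  rewrite mxE -val_eqE /= !inordK; try lia.
  by move: (i : nat) (k : nat) si sk => a b *; index_cases.
by move: (i : nat) (k : nat) => a b *; index_cases.
Qed.

(** Each edge of the block gives mass 1/2 to both its endpoints: inner nodes collect 1, the two
    extreme nodes 1/2. Thus the mass matrix too is described by edges. *)
Lemma embed_half_diag n w s : (0 < w)%N -> (s + w <= n)%N ->
  embed_block n.+1 s (half_id R w) =
  diag_mx (\row_(i < n.+1)
    (((s <= i < s + w)%:R + (0 < i)%:R * (s <= i.-1 < s + w)%:R) / 2)).
Proof.
move=> w0 swn; apply/matrixP => i k; rewrite !mxE -!val_eqE /=.
have := leq_ord i; have := leq_ord k; case: ifPn => [/andP[si sk]|].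
  rewrite -?val_eqE /= !inordK; try lia.
  move: (i : nat) (k : nat) si sk => a b *.
  by rewrite ?[_ *+ (a == b)]mulrb; index_cases.
by move: (i : nat) (k : nat) => a b *; rewrite ?[_ *+ (a == b)]mulrb; index_cases.
Qed.

(** The corner matrix is the Laplacian of the single edge that closes the path into a cycle. *)
Lemma corner_gram n : (0 < n)%N ->
  corner R n = (diff_row n 0 n)^T *m diff_row n 0 n.
Proof.
move=> n0; apply/matrixP => i k; rewrite !mxE big_ord1 !mxE -val_eqE /=.
have := leq_ord i; have := leq_ord k; move: (i : nat) (k : nat) => a b bn an.
by index_cases.
Qed.

(** A cycle is a path plus its closing edge. For [n = 1] these two edges would join the same nodes,
    while the circulant has only a single -1 there. *)
Lemma lap_perE n : (1 < n)%N -> lap_per R n = lap_neumann R n + corner R n.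
Proof.
move=> n1; apply/matrixP => i k; rewrite !mxE -!val_eqE /=.
(* The modular difference wraps around exactly when [i < k]. *)
have -> : ((i + (n.+1 - k) %% n.+1) %% n.+1)%N
          = (if k <= i then i - k else i + n.+1 - k)%N.
  have := ltn_ord i; have := ltn_ord k.
  move: (i : nat) (k : nat) => a b bn an; rewrite modnDmr.
  case: leqP => ab; last by rewrite modn_small; lia.
  by rewrite (_ : (a + _)%N = (a - b + n.+1)%N) ?modnDr ?modn_small; lia.
have := leq_ord i; have := leq_ord k; move: (i : nat) (k : nat) => a b bn an.
by case: (leqP b a) => ?; index_cases.
Qed.

Lemma diff_row_mul n (a b : 'I_n.+1) (u : 'cV[R]_n.+1) :
  (diff_row n a b *m u) 0 0 = u a 0 - u b 0.
Proof.
rewrite mxE; under eq_bigr do rewrite mxE mulrBl !val_eqE.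
rewrite sumrB (bigD1 a) //= eqxx mul1r big1 => [|i /negPf ->]; last first.
  by rewrite mul0r.
rewrite (bigD1 b) //= eqxx mul1r big1 => [|i /negPf ->]; last by rewrite mul0r.
by rewrite !addr0.
Qed.

Lemma diff_row_const n (a b : nat) : (a <= n)%N -> (b <= n)%N ->
  diff_row n a b *m (const_mx 1 : 'cV_n.+1) = 0.
Proof.
rewrite -[(a <= n)%N]ltnS -[(b <= n)%N]ltnS => an bn; apply/colP => i.
by rewrite ord1 (diff_row_mul (Ordinal an) (Ordinal bn)) !mxE subrr.
Qed.

Lemma psd_lap_neumann n : (0 < n)%N -> psd (lap_neumann R n).
Proof. by move=> n0; rewrite lap_neumann_path //; apply: psd_path_lap. Qed.

Lemma psd_corner n : (0 < n)%N -> psd (corner R n).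
Proof. by move=> n0; rewrite corner_gram //; exact: psd_gram. Qed.

Lemma psd_lap_per n : (1 < n)%N -> psd (lap_per R n).
Proof.
move=> n1; rewrite lap_perE //; apply: psdD.
  by apply: psd_lap_neumann; exact: ltnW.
by apply: psd_corner; exact: ltnW.
Qed.

Lemma qform_path_lap n c u :
  qform (path_lap n c) u
  = \sum_(e < n) c e * (u (inord e) 0 - u (inord e.+1) 0) ^+ 2.
Proof.
have -> : qform (path_lap n c) u
  = \sum_(e < n) qform (c e *: ((diff_row n e e.+1)^T *m diff_row n e e.+1)) u.
  rewrite /path_lap; elim/big_rec2: _ => [|e X Y _ <-]; last by rewrite qformD.
  by rewrite /qform mulmx0 mul0mx mxE.
apply: eq_bigr => e _; rewrite qformZ qform_gram big_ord1 -diff_row_mul.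
by rewrite !inordK // ltnS // ltnW.
Qed.

(** Zero energy forces zero path energy, which already equates consecutive entries. *)
Lemma kernel_constant_lap_per n : (1 < n)%N -> kernel_constant (lap_per R n).
Proof.
move=> n1; have n0 := ltnW n1; rewrite lap_perE //; split=> [|u].
  rewrite mulmxDl corner_gram // -mulmxA diff_row_const // mulmx0 addr0.
  rewrite lap_neumann_path // mulmx_suml big1 // => e _.
  by rewrite scale1r -mulmxA diff_row_const ?mulmx0 // ltnW.
move=> /(congr1 (fun v => (u^T *m v) 0 0)).
rewrite mulmxA -/(qform _ u) qformD mulmx0 mxE => /eqP.
have qN := psd_qform_ge0 u (psd_lap_neumann n0).
have qC := psd_qform_ge0 u (psd_corner n0).
rewrite paddr_eq0 //.
rewrite lap_neumann_path // qform_path_lap => /andP[+ _].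
rewrite psumr_eq0 => [/allP u0|e _]; last by rewrite mul1r sqr_ge0.
have step e : (e < n)%N -> u (inord e.+1) 0 = u (inord e) 0.
  move=> en; have := u0 (Ordinal en) (mem_index_enum _).
  by rewrite /= mul1r sqrf_eq0 subr_eq0 => /eqP.
suff const e : (e <= n)%N -> u (inord e) 0 = u ord0 0.
  by move=> i j; rewrite -(inord_val i) -(inord_val j) !const // leq_ord.
elim: e => [_|e IH en]; first by congr (u _ _); apply: val_inj; rewrite /= inordK.
by rewrite step // IH // ltnW.
Qed.

End PathLaplacian.

(** * Sub-cells and the bounds [0 <= A_stoch <= A_lap] *)

Section Cells.
Variables (R : realType) (n0 L w : nat).
Hypotheses (w_gt0 : (0 < w)%N) (w_even : ~~ odd w) (n0_even : ~~ odd n0).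
Hypothesis w_le : (w <= n0)%N.

Local Notation n := (n0 * L)%N.

(* The grid edge [e] joins the nodes [e] and [e.+1]. *)
Definition cell_edge (j : 'I_L) (e : nat) : bool :=
  (cell_start n0 w j <= e < cell_start n0 w j + w)%N.

Definition edge_count (e : nat) : R := \sum_(j < L) (cell_edge j e)%:R.

Lemma cell_start_le (j : 'I_L) : (cell_start n0 w j + w <= n)%N.
Proof.
have jL : (j.+1 * n0 <= L * n0)%N by rewrite leq_mul2r ltn_ord orbT.
by rewrite /cell_start (mulnC n0); lia.
Qed.

(** Edges are tracked rather than nodes: when [w = n0], neighbouring sub-cells share a node, but
    their half-open edge ranges stay disjoint. *)
Lemma cell_edge_inj e (j j' : 'I_L) : cell_edge j e -> cell_edge j' e -> j = j'.
Proof.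
rewrite /cell_edge /cell_start => je j'e; apply: val_inj => /=.
have [jj'|jj'|//] := ltngtP j j'.
  have : (j.+1 * n0 <= j' * n0)%N by rewrite leq_mul2r jj' orbT.
  lia.
have : (j'.+1 * n0 <= j * n0)%N by rewrite leq_mul2r jj' orbT.
lia.
Qed.

Lemma edge_count_le1 e : edge_count e <= 1.
Proof.
have [[j je]|none] := pselect (exists j, cell_edge j e).
  rewrite /edge_count (bigD1 j) //= je big1 ?addr0 // => j' j'j.
  case j'e : (cell_edge j' e) => //.
  by rewrite (cell_edge_inj j'e je) eqxx in j'j.
rewrite /edge_count big1 // => j _; case je : (cell_edge j e) => //.
by case: none; exists j.
Qed.

Lemma QbarE (j : 'I_L) :
  Qbar R n0 w j = path_lap n (fun e => (cell_edge j e)%:R).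
Proof. by apply: embed_neumann_path => //; exact: cell_start_le. Qed.

Lemma IbarE (j : 'I_L) :
  Ibar R n0 w j = diag_mx (\row_(i < n.+1)
    (((cell_edge j i)%:R + (0 < i)%:R * (cell_edge j i.-1)%:R) / 2)).
Proof. by apply: embed_half_diag => //; exact: cell_start_le. Qed.

Lemma psd_Qbar (j : 'I_L) : psd (Qbar R n0 w j).
Proof. by rewrite QbarE; apply: psd_path_lap => e; exact: ler0n. Qed.

Lemma psd_Ibar (j : 'I_L) : psd (Ibar R n0 w j).
Proof.
rewrite IbarE; apply: psd_diag => i; rewrite mxE.
by rewrite divr_ge0 ?addr_ge0 ?mulr_ge0 ?ler0n.
Qed.

(** The difference is the path Laplacian with the nonnegative conductances [1 - edge_count e]. *)
Lemma sum_Qbar_le : (0 < n)%N ->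
  psd (lap_neumann R n - \sum_(j < L) Qbar R n0 w j).
Proof.
move=> n_gt0; rewrite lap_neumann_path //.
under eq_bigr do rewrite QbarE.
rewrite -path_lap_sum -path_lapB; apply: psd_path_lap => e.
by rewrite subr_ge0 edge_count_le1.
Qed.

(** A node shared by two sub-cells receives 1/2 from each: every diagonal entry of the sum is at
    most the average of two edge counts, hence at most 1. *)
Lemma sum_Ibar_le : psd (1%:M - \sum_(j < L) Ibar R n0 w j).
Proof.
have -> : 1%:M - \sum_(j < L) Ibar R n0 w j = diag_mx (\row_(i < n.+1)
    (1 - (edge_count i + (0 < i)%:R * edge_count i.-1) / 2)).
  apply/matrixP => i k; rewrite !mxE summxE.
  under eq_bigr do rewrite IbarE !mxE.
  have [_|_] := eqVneq i k; last by rewrite big1 // subr0.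
  by rewrite /edge_count !mulr1n -mulr_suml big_split -mulr_sumr.
apply: psd_diag => i; rewrite mxE.
have := edge_count_le1 i; have := edge_count_le1 i.-1.
by case: (0 < i)%N; rewrite ?(mul1r, mul0r); lra.
Qed.

Variables (d : nat) (K : {set d.-tuple 'I_L}).
Hypothesis n_gt1 : (1 < n)%N.

Let cell_term (i : 'I_d) (j : d.-tuple 'I_L) : 'M[R]_(n.+1 ^ d) :=
  kron (fun k => if k == i then Qbar R n0 w (tnth j k)
                 else Ibar R n0 w (tnth j k)).

Let psd_cell_term i j : psd (cell_term i j).
Proof.
by apply: psd_kron => k; case: ifP => _; [exact: psd_Qbar | exact: psd_Ibar].
Qed.

Lemma psd_A_stoch : psd (A_stoch R n0 w K).
Proof.
apply: psdD; last by apply/psd_kron_sum/psd_corner/ltnW.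
by apply: psd_sum => j _; apply: psd_sum => i _; exact: psd_cell_term.
Qed.

Lemma psd_A_stoch_le : psd (A_lap R d n0 L - A_stoch R n0 w K).
Proof.
(* The corner parts cancel, leaving the Neumann Kronecker sum against the cells. *)
rewrite /A_lap /A_stoch lap_perE // kron_sumD opprD addrACA subrr addr0.
(* The intermediate matrix takes all cells instead of [K]. *)
apply: (@psd_le_trans _ _ _ (\sum_j \sum_i cell_term i j)).
  rewrite [X in X - _](bigID (mem K)) /= addrAC subrr add0r.
  by apply: psd_sum => j _; apply: psd_sum => i _; exact: psd_cell_term.
rewrite exchange_big -sumrB; apply: psd_sum => i _ /=.
(* For a fixed direction [i] the sum over all cells is one Kronecker product, so the comparison can
   be made factor by factor. *)
rewrite -(kron_distr (fun k l => if k == i then Qbar R n0 w l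
                                 else Ibar R n0 w l)).
apply: psd_kron_le => k.
  by apply: psd_sum => l _; case: ifP => _; [exact: psd_Qbar | exact: psd_Ibar].
case: (k == i); last exact: sum_Ibar_le.
by apply: sum_Qbar_le; exact: ltnW.
Qed.

End Cells.

Theorem lemma4p1 (R : realType) (d : nat) (hd : d = 2%N \/ d = 3%N) :
  exists2 C : R, 0 < C &
    forall (p0 n0 L w : nat) (alpha lambda : R) (K : {set d.-tuple 'I_L}),
      (2 <= p0)%N -> n0 = (2 ^ p0)%N -> (1 <= L)%N ->
      2 * alpha * n0%:R = w%:R -> ~~ odd w -> (2 <= w <= n0)%N ->
      0 < lambda -> lambda <= 1 ->
      exists2 c : R,
        is_cond_on (@ones_orth R ((n0 * L).+1 ^ d))
          (mp_pinv (B_lap d n0 L lambda) *m A_stiff n0 w lambda K) c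
        & c <= C * lambda^-1.
Proof.
have [d' d'E] : exists d', d = d'.+1 by case: hd => ->; [exists 1%N | exists 2%N].
exists 1; first exact: ltr01.
move=> p0 n0 L w alpha lambda K p0_ge2 n0E L_gt0 _ w_even /andP[w_ge2 w_le].
move=> l_gt0 l_le1.
have n0_even : ~~ odd n0 by rewrite n0E oddX; lia.
have n_gt1 : (1 < n0 * L)%N.
  by rewrite (leq_trans (leq_trans w_ge2 w_le)) ?leq_pmulr.
have w_gt0 : (0 < w)%N by exact: ltnW.
have pA := psd_A_stoch R w_gt0 w_even n0_even w_le K n_gt1.
have pB := psd_A_stoch_le R w_gt0 w_even n0_even w_le K n_gt1.
have pL : psd (A_lap R d n0 L) by apply/psd_kron_sum/psd_lap_per.
have kL : kernel_constant (A_lap R d n0 L).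
  rewrite /A_lap d'E; apply: kernel_constant_kron_sum; first exact: psd_lap_per.
  exact: kernel_constant_lap_per.
pose t : R := (1 + lambda) / 2.
have t_gt0 : 0 < t by rewrite /t; lra.
(* As [B_lap] is [t] times [A_lap], these constants express [lambda A_lap <= A <= A_lap]. *)
have [||||||c cond_c c_le] := @pencil_cond R _ (A_stiff n0 w lambda K)
  (B_lap d n0 L lambda) (lambda / t) t^-1.
- by apply: psdZ => //; exact: ltW.
- case: kL => L1 kL; split=> [|u]; first by rewrite -scalemxAl L1 scaler0.
  rewrite -scalemxAl => /eqP; rewrite scaler_eq0 gt_eqF //= => /eqP; exact: kL.
- exact: divr_gt0.
(* Here [A - lambda A_lap] is [(1 - lambda) A_stoch]. *)
- rewrite /B_lap scalerA divfK ?gt_eqF // /A_stiff addrC addKr.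
  by apply: psdZ => //; rewrite subr_ge0.
- rewrite /B_lap scalerA mulVf ?gt_eqF // scale1r.
  have -> : A_lap R d n0 L - A_stiff n0 w lambda K
            = (1 - lambda) *: (A_lap R d n0 L - A_stoch R n0 w K).
    rewrite /A_stiff scalerBr opprD addrA; congr (_ - _).
    by rewrite scalerBl scale1r.
  by apply: psdZ => //; rewrite subr_ge0.
- rewrite d'E expnS (leq_trans n_gt1) // (leq_trans (leqnSn _)) //.
  by rewrite leq_pmulr // expn_gt0.
exists c => //; apply: le_trans c_le _.
(* The factor [t] cancels in the quotient of the two bounds. *)
by rewrite mul1r (invf_div lambda) mulrA mulVf ?mul1r // gt_eqF.
Qed.
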